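(* Let $T$ be a truss, let $K\xleftarrow{f}G\xrightarrow{g}H$ be a diagram of heaps of $T$-modules with $G$ non-empty, and let $e\in G$. Consider the induced diagram $\mathcal{G}(K;f(e))\xleftarrow{f}\mathcal{G}(G;e)\xrightarrow{g}\mathcal{G}(H;g(e))$ of pointed $T$-modules, and its pushout in the category of pointed $T$-modules, realised as $$P=\big(\mathcal{G}(K;f(e))\oplus\mathcal{G}(H;g(e))\big)/\{(f(x),-g(x))\mid x\in G\}$$ with the canonical maps $\eta_K\colon K\to P$ and $\eta_H\colon H\to P$. Then the heap of $T$-modules associated with $P$, together with $\eta_K$ and $\eta_H$, is the pushout of $K\xleftarrow{f}G\xrightarrow{g}H$ in the category of heaps of $T$-modules.
   Context: An abelian heap is a (possibly empty) set $H$ with a ternary operation $[-,-,-]$ satisfying $[a,b,[c,d,e]]=[[a,b,c],d,e]$, $[a,b,b]=a=[b,b,a]$ and $[a,b,c]=[c,b,a]$; heap morphisms preserve the bracket. A truss is an abelian heap $T$ with an associative binary multiplication such that $t[s,s',s'']=[ts,ts',ts'']$ and $[s,s',s'']t=[st,s't,s''t]$ (not assumed unital, possibly empty). A left $T$-module is an abelian heap $M$ with an action $\cdot\colon T\times M\to M$ with $t\cdot(t'\cdot m)=(tt')\cdot m$, $[t,t',t'']\cdot m=[t\cdot m,t'\cdot m,t''\cdot m]$, $t\cdot[m,n,e]=[t\cdot m,t\cdot n,t\cdot e]$. A heap of $T$-modules is an abelian heap $M$ (possibly empty) with an operation $T\times M\times M\to M$, $(t,m,n)\mapsto t\triangleright_m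 n$, such that for each $m\in M$ the map $(t,n)\mapsto t\triangleright_m n$ makes $M$ a left $T$-module, and $t\triangleright_m n=[t\triangleright_e n,t\triangleright_e m,m]$ for all $m,n,e\in M$, $t\in T$. Morphisms are heap morphisms $f$ with $f(t\triangleright_m n)=t\triangleright_{f(m)}f(n)$. A pointed $T$-module is an abelian group $G$ with a map $\cdot\colon T\times G\to G$ such that $t\cdot(t'\cdot g)=(tt')\cdot g$, $[t,t',t'']\cdot g=t\cdot g-t'\cdot g+t''\cdot g$ and $t\cdot(g+h)=t\cdot g+t\cdot h$. Morphisms are group homomorphisms $f$ with $f(t\cdot g)=t\cdot f(g)$. A pointed $T$-module $G$ has an associated heap of $T$-modules with $[x,y,z]=x-y+z$ and $t\triangleright_x y=t\cdot y-t\cdot x+x$. Conversely, for a non-empty heap of $T$-modules $(M,\triangleright)$ and $e\in M$, $\mathcal{G}(M;e)$ denotes the pointed $T$-module on the set $M$ with addition $x+y=[x,e,y]$ (zero $e$) and action $t\cdot x=t\triangleright_e x$. *)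

(* Defs.v *)
From HB Require Import structures.
From mathcomp Require Import all_boot all_algebra.
From mathcomp Require Import boolp.

Set Implicit Arguments.
Unset Strict Implicit.
Unset Printing Implicit Defensive.

Import GRing.Theory Quotient.
Local Open Scope ring_scope.
Local Open Scope quotient_scope.

(* Heaps are structures on a bare Type: they may be empty, and no decidable   *)
(* equality or choice operator is assumed.                                    *)
HB.mixin Record isAbHeap (H : Type) := {
  hbr : H -> H -> H -> H;
  hbrA : forall a b c d e, hbr a b (hbr c d e) = hbr (hbr a b c) d e;
  hbrKr : forall a b, hbr a b b = a;
  hbrKl : forall a b, hbr b b a = a;
  hbrC : forall a b c, hbr a b c = hbr c b a
}.
#[short(type="abHeapType")]
HB.structure Definition AbHeap := {H of isAbHeap H}.

Notation "[heap a , b , c ]" := (hbr a b c) (at level 0, a, b, c at level 99).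

Definition heap_morphism (M N : abHeapType) (f : M -> N) : Prop :=
  forall a b c, f [heap a, b, c] = [heap f a, f b, f c].

HB.mixin Record isTruss (T : Type) of AbHeap T := {
  tmul : T -> T -> T;
  tmulA : associative tmul;
  tmul_hbrr : forall t s s' s'' : T,
    tmul t [heap s, s', s''] = [heap tmul t s, tmul t s', tmul t s''];
  tmul_hbrl : forall s s' s'' t : T,
    tmul [heap s, s', s''] t = [heap tmul s t, tmul s' t, tmul s'' t]
}.
#[short(type="trussType")]
HB.structure Definition Truss := {T of isTruss T & AbHeap T}.

Record is_left_module (T : trussType) (M : abHeapType) (act : T -> M -> M) :
    Prop := IsLeftModule {
  lmod_actA : forall t t' m, act t (act t' m) = act (tmul t t') m;
  lmod_act_hbrl : forall t t' t'' m,
    act [heap t, t', t''] m = [heap act t m, act t' m, act t'' m];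
  lmod_act_hbrr : forall t m n e,
    act t [heap m, n, e] = [heap act t m, act t n, act t e]
}.

(* [hact t m n] is t |>_m n. *)
HB.mixin Record isHeapOfModules (T : trussType) (M : Type) of AbHeap M := {
  hact : T -> M -> M -> M;
  hact_lmod : forall m : M, is_left_module (fun t n => hact t m n);
  hact_base : forall (t : T) (m n e : M),
    hact t m n = [heap hact t e n, hact t e m, m]
}.
#[short(type="hmodType")]
HB.structure Definition HeapOfModules (T : trussType) :=
  {M of isHeapOfModules T M & AbHeap M}.

Definition hmod_morphism (T : trussType) (M N : hmodType T) (f : M -> N) :
    Prop :=
  heap_morphism f /\
  forall (t : T) (m n : M), f (hact t m n) = hact t (f m) (f n).

HB.mixin Record isHModMorphism (T : trussType) (M N : hmodType T)
    (f : M -> N) := {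
  hmod_morphismP : hmod_morphism f
}.
HB.structure Definition HModMorphism (T : trussType) (M N : hmodType T) :=
  {f of isHModMorphism T M N f}.
Notation "{ 'hmod' M -> N }" := (HModMorphism.type M N)
  (at level 0, M at level 98, N at level 99, format "{ 'hmod'  M  ->  N }").

HB.mixin Record isPointedModule (T : trussType) (G : Type)
    of GRing.Zmodule G := {
  pact : T -> G -> G;
  pactA : forall (t t' : T) (x : G), pact t (pact t' x) = pact (tmul t t') x;
  pact_hbrl : forall (t t' t'' : T) (x : G),
    pact [heap t, t', t''] x = pact t x - pact t' x + pact t'' x;
  pactD : forall (t : T) (x y : G), pact t (x + y) = pact t x + pact t y
}.
#[short(type="pmodType")]
HB.structure Definition PointedModule (T : trussType) :=
  {G of isPointedModule T G & GRing.Zmodule G}.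

Definition pmod_morphism (T : trussType) (A B : pmodType T) (f : A -> B) :
    Prop :=
  zmod_morphism f /\ forall (t : T) (x : A), f (pact t x) = pact t (f x).

HB.mixin Record isPModMorphism (T : trussType) (A B : pmodType T)
    (f : A -> B) := {
  pmod_morphismP : pmod_morphism f
}.
HB.structure Definition PModMorphism (T : trussType) (A B : pmodType T) :=
  {f of isPModMorphism T A B f}.
Notation "{ 'pmod' A -> B }" := (PModMorphism.type A B)
  (at level 0, A at level 98, B at level 99, format "{ 'pmod'  A  ->  B }").

Definition hmod_pushout (T : trussType) (G K H P : hmodType T)
    (f : G -> K) (g : G -> H) (iK : K -> P) (iH : H -> P) : Prop :=
  [/\ hmod_morphism iK, hmod_morphism iH, iK \o f =1 iH \o g &
    forall (X : hmodType T) (u : K -> X) (v : H -> X),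
      hmod_morphism u -> hmod_morphism v -> u \o f =1 v \o g ->
      exists w : P -> X,
        [/\ hmod_morphism w, w \o iK =1 u, w \o iH =1 v &
          forall w' : P -> X, hmod_morphism w' ->
            w' \o iK =1 u -> w' \o iH =1 v -> w' =1 w]].

Definition pmod_pushout (T : trussType) (C A B P : pmodType T)
    (f : C -> A) (g : C -> B) (iA : A -> P) (iB : B -> P) : Prop :=
  [/\ pmod_morphism iA, pmod_morphism iB, iA \o f =1 iB \o g &
    forall (X : pmodType T) (u : A -> X) (v : B -> X),
      pmod_morphism u -> pmod_morphism v -> u \o f =1 v \o g ->
      exists w : P -> X,
        [/\ pmod_morphism w, w \o iA =1 u, w \o iB =1 v &
          forall w' : P -> X, pmod_morphism w' ->
            w' \o iA =1 u -> w' \o iB =1 v -> w' =1 w]].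

Section PointedModuleTheory.
Variables (T : trussType) (G : pmodType T).
Implicit Types (t : T) (x y : G).

Lemma pact0 t : pact t (0 : G) = 0.
Proof. by apply: (addrI (pact t 0)); rewrite -pactD !addr0. Qed.

Lemma pactN t x : pact t (- x) = - pact t x.
Proof. by apply: (addrI (pact t x)); rewrite -pactD !subrr pact0. Qed.

Lemma pactB t x y : pact t (x - y) = pact t x - pact t y.
Proof. by rewrite pactD pactN. Qed.

End PointedModuleTheory.

Definition heap_of (T : trussType) (G : pmodType T) : Type := G.

Section HeapOfPointedModule.
Variables (T : trussType) (G : pmodType T).

Let br (x y z : G) : G := x - y + z.
Let tri (t : T) (x y : G) : G := pact t y - pact t x + x.

Fact heap_of_brA a b c d e : br a b (br c d e) = br (br a b c) d e.
Proof. by rewrite /br !addrA. Qed.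
Fact heap_of_brKr a b : br a b b = a. Proof. exact: subrK. Qed.
Fact heap_of_brKl a b : br b b a = a. Proof. by rewrite /br subrr add0r. Qed.
Fact heap_of_brC a b c : br a b c = br c b a.
Proof. by rewrite /br addrAC [a + c]addrC addrAC. Qed.

HB.instance Definition _ := isAbHeap.Build (heap_of G)
  heap_of_brA heap_of_brKr heap_of_brKl heap_of_brC.

Let brDr x y z m : br x y z + m = br (x + m) (y + m) (z + m).
Proof. by rewrite /br [y + m]addrC addrKA addrA. Qed.

Let triE t x y : tri t x y = pact t (y - x) + x.
Proof. by rewrite pactB. Qed.

Fact heap_of_lmod (m : heap_of G) :
  @is_left_module T (heap_of G) (fun t n => tri t m n).
Proof.
split=> [t t' n|t t' t'' n|t n n' n'']; rewrite /hbr/= !triE.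
- by rewrite addrK pactA.
- by rewrite pact_hbrl brDr.
- by rewrite (brDr n n' n'' (- m)) /br pactD pactB (brDr _ _ _ m).
Qed.

Fact heap_of_base t m n e : tri t m n = br (tri t e n) (tri t e m) m.
Proof.
rewrite !triE /br [pact t (m - _) + _]addrC addrKA -pactB; congr (pact _ _ + _).
by rewrite opprB addrA subrK.
Qed.

HB.instance Definition _ :=
  isHeapOfModules.Build T (heap_of G) heap_of_lmod heap_of_base.

End HeapOfPointedModule.

(* G(M; e); the Equality and Choice structures underlying the group are       *)
(* classical.                                                                 *)
Definition retract (T : trussType) (M : hmodType T) (e : M) : Type := M.

Section Retract.
Variables (T : trussType) (M : hmodType T) (e : M).

Let add (x y : M) : M := [heap x, e, y].
Let opp (x : M) : M := [heap e, x, e].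
Let act (t : T) (x : M) : M := hact t e x.

HB.instance Definition _ := gen_eqMixin (retract e).
HB.instance Definition _ := gen_choiceMixin (retract e).

Fact retract_addA : associative add.
Proof. by move=> x y z; rewrite /add hbrA. Qed.
Fact retract_addC : commutative add.
Proof. by move=> x y; rewrite /add hbrC. Qed.
Fact retract_add0 : left_id e add.
Proof. by move=> x; rewrite /add hbrKl. Qed.
Fact retract_addN : left_inverse e opp add.
Proof. by move=> x; rewrite /add /opp -hbrA hbrKl hbrKr. Qed.

HB.instance Definition _ := GRing.isZmodule.Build (retract e)
  retract_addA retract_addC retract_add0 retract_addN.

Lemma retract_brE (x y z : retract e) : x - y + z = [heap x : M, y, z].
Proof.
rewrite /GRing.add /GRing.opp /= /add /opp.
by rewrite hbrA hbrKr -hbrA hbrKl.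
Qed.

Lemma retract_subE (x y : retract e) : x - y = [heap x : M, y, e].
Proof. by rewrite -retract_brE addr0. Qed.

Lemma hact_id t (m : M) : hact t m m = m.
Proof. by rewrite (hact_base _ _ _ m) hbrKl. Qed.

Fact retract_actA t t' x : act t (act t' x) = act (tmul t t') x.
Proof. exact: lmod_actA (hact_lmod e) _ _ _. Qed.
Fact retract_act_hbrl t t' t'' (x : retract e) :
  act [heap t, t', t''] x =
    (act t x : retract e) - (act t' x : retract e) + (act t'' x : retract e).
Proof. by rewrite retract_brE; exact: lmod_act_hbrl (hact_lmod e) _ _ _ _. Qed.
Fact retract_actD t x y : act t (add x y) = add (act t x) (act t y).
Proof.
by rewrite /act /add (lmod_act_hbrr (hact_lmod e)) hact_id.
Qed.

HB.instance Definition _ := isPointedModule.Build T (retract e)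
  retract_actA retract_act_hbrl retract_actD.

End Retract.

Definition retract_map (T : trussType) (M N : hmodType T) (f : M -> N) (e : M)
  : retract e -> retract (f e) := f.
Arguments retract_map {T M N} f e _.

Section RetractMap.
Variables (T : trussType) (M N : hmodType T) (f : {hmod M -> N}) (e : M).

Fact retract_map_morphism : pmod_morphism (retract_map f e).
Proof.
have [fB fact] := @hmod_morphismP _ _ _ f.
by split=> [x y|t x]; [rewrite !retract_subE; exact: fB | exact: fact].
Qed.

HB.instance Definition _ := isPModMorphism.Build T (retract e) (retract (f e))
  (retract_map f e) retract_map_morphism.

End RetractMap.

Section DirectSum.
Variables (T : trussType) (A B : pmodType T).

Let act (t : T) (p : A * B) : A * B := (pact t p.1, pact t p.2).

Fact dsum_actA t t' p : act t (act t' p) = act (tmul t t') p.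
Proof. by rewrite /act !pactA. Qed.
Fact dsum_act_hbrl t t' t'' p :
  act [heap t, t', t''] p = act t p - act t' p + act t'' p.
Proof. by rewrite /act !pact_hbrl. Qed.
Fact dsum_actD t p q : act t (p + q) = act t p + act t q.
Proof. by rewrite /act !pactD. Qed.

HB.instance Definition _ := isPointedModule.Build T (A * B)%type
  dsum_actA dsum_act_hbrl dsum_actD.

End DirectSum.

Definition antidiag (T : trussType) (C A B : pmodType T) (f : C -> A)
    (g : C -> B) : {pred A * B} :=
  fun p => `[< exists x, p = (f x, - g x) >].

Section PushoutOfPointedModules.
Variables (T : trussType) (C A B : pmodType T).
Variables (f : {pmod C -> A}) (g : {pmod C -> B}).

Fact antidiag_closed : zmod_closed (antidiag f g).
Proof.
have [[fB _] [gB _]] := (@pmod_morphismP _ _ _ f, @pmod_morphismP _ _ _ g).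
split.
  apply/asboolP; exists (0 - 0).
  by rewrite fB gB !subrr oppr0.
move=> _ _ /asboolP[x ->] /asboolP[y ->]; apply/asboolP; exists (x - y).
by rewrite fB gB opprD.
Qed.

HB.instance Definition _ :=
  GRing.isZmodClosed.Build (A * B)%type (antidiag f g) antidiag_closed.

Lemma antidiag_act (t : T) p : p \in antidiag f g -> pact t p \in antidiag f g.
Proof.
have [[_ fact] [_ gact]] := (@pmod_morphismP _ _ _ f, @pmod_morphismP _ _ _ g).
move=> /asboolP[x ->]; apply/asboolP; exists (pact t x).
by rewrite fact gact -pactN.
Qed.

Definition pushout : Type := {quot (antidiag f g)}.
HB.instance Definition _ := GRing.Zmodule.on pushout.

Definition pushout_pi (p : A * B) : pushout := \pi_{quot (antidiag f g)} p.

Lemma pushout_piB : {morph pushout_pi : p q / p - q}.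
Proof. exact: (raddfB \pi_{quot (antidiag f g)}). Qed.

Lemma pushout_piD : {morph pushout_pi : p q / p + q}.
Proof. exact: (raddfD \pi_{quot (antidiag f g)}). Qed.

Lemma pushout_piP (x : pushout) : exists p, x = pushout_pi p.
Proof. by exists (repr x); rewrite /pushout_pi reprK. Qed.

Lemma pushout_pi_eq p q :
  pushout_pi p = pushout_pi q <-> p - q \in antidiag f g.
Proof. by rewrite idealrBE; split=> [/eqP|/eqP]. Qed.

Definition pushout_act (t : T) (x : pushout) : pushout :=
  pushout_pi (pact t (repr x)).

Lemma pushout_act_pi t p : pushout_act t (pushout_pi p) = pushout_pi (pact t p).
Proof.
apply/pushout_pi_eq; rewrite -pactB; apply: antidiag_act.
by apply/pushout_pi_eq; rewrite /pushout_pi reprK.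
Qed.

Fact pushout_actA t t' x :
  pushout_act t (pushout_act t' x) = pushout_act (tmul t t') x.
Proof. by have [p ->] := pushout_piP x; rewrite !pushout_act_pi pactA. Qed.
Fact pushout_act_hbrl t t' t'' x :
  pushout_act [heap t, t', t''] x =
    pushout_act t x - pushout_act t' x + pushout_act t'' x.
Proof.
have [p ->] := pushout_piP x.
by rewrite !pushout_act_pi pact_hbrl pushout_piD pushout_piB.
Qed.
Fact pushout_actD t x y :
  pushout_act t (x + y) = pushout_act t x + pushout_act t y.
Proof.
have [[p ->] [q ->]] := (pushout_piP x, pushout_piP y).
by rewrite -pushout_piD !pushout_act_pi pactD pushout_piD.
Qed.

HB.instance Definition _ := isPointedModule.Build T pushout
  pushout_actA pushout_act_hbrl pushout_actD.

Definition pushout_inl (a : A) : pushout := pushout_pi (a, 0).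
Definition pushout_inr (b : B) : pushout := pushout_pi (0, b).

End PushoutOfPointedModules.
Arguments pushout_pi {T C A B} f g _.
Arguments pushout_inl {T C A B} f g _.
Arguments pushout_inr {T C A B} f g _.

Section HeapPushout.
Variables (T : trussType) (G K H : hmodType T).
Variables (f : {hmod G -> K}) (g : {hmod G -> H}) (e : G).

Definition retract_pushout : pmodType T :=
  pushout (retract_map f e) (retract_map g e).

Definition eta_l : retract (f e) -> retract_pushout :=
  pushout_inl (retract_map f e) (retract_map g e).
Definition eta_r : retract (g e) -> retract_pushout :=
  pushout_inr (retract_map f e) (retract_map g e).

End HeapPushout.
Arguments eta_l {T G K H} f g e _.
Arguments eta_r {T G K H} f g e _.

(* Main.v *)
(** A heap morphism between pointed modules that fixes the zero is a morphism
    of pointed modules, and conversely.  So a cocone [u \o f = v \o g] of heaps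
    of modules with vertex [X] is a cocone of pointed modules with vertex
    [G(X; u (f e))], and any mediating heap morphism [w] out of [P] satisfies
    [w 0 = w (eta_K (f e)) = u (f e)], hence is the mediating morphism of
    pointed modules. *)
Require Import Defs.
From HB Require Import structures.
From mathcomp Require Import all_boot all_algebra.
From mathcomp Require Import boolp.

Set Implicit Arguments.
Unset Strict Implicit.
Unset Printing Implicit Defensive.

Import GRing.Theory.
Local Open Scope ring_scope.

Section PointedModuleMorphisms.
Variables (T : trussType) (A B : pmodType T) (w : A -> B).
Hypothesis w_pmod : pmod_morphism w.

Lemma pmod_morphismB : {morph w : x y / x - y}.
Proof. by case: w_pmod. Qed.

Lemma pmod_morphism0 : w 0 = 0.
Proof. by rewrite -(subrr 0) pmod_morphismB subrr. Qed.

Lemma pmod_morphismN : {morph w : x / - x}.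
Proof. by move=> x; rewrite -sub0r pmod_morphismB pmod_morphism0 sub0r. Qed.

Lemma pmod_morphismD : {morph w : x y / x + y}.
Proof.
by move=> x y; rewrite -{1}[y]opprK pmod_morphismB pmod_morphismN opprK.
Qed.

Lemma pmod_morphismZ t x : w (pact t x) = pact t (w x).
Proof. by have [_ ->] := w_pmod. Qed.

End PointedModuleMorphisms.

Section PointedModulePushout.
Variables (T : trussType) (C A B : pmodType T).
Variables (f : {pmod C -> A}) (g : {pmod C -> B}).

Lemma pact_pushout_pi t p :
  pact t (pushout_pi f g p) = pushout_pi f g (pact t p).
Proof. exact: pushout_act_pi. Qed.

Lemma pushout_inl_morphism : pmod_morphism (pushout_inl f g).
Proof.
split=> [x y|t x].
  rewrite /pushout_inl -pushout_piB; congr (pushout_pi f g (_, _)).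
  by rewrite /= subr0.
rewrite /pushout_inl pact_pushout_pi; congr (pushout_pi f g (_, _)).
by rewrite /= pact0.
Qed.

Lemma pushout_inr_morphism : pmod_morphism (pushout_inr f g).
Proof.
split=> [x y|t x].
  rewrite /pushout_inr -pushout_piB; congr (pushout_pi f g (_, _)).
  by rewrite /= subr0.
rewrite /pushout_inr pact_pushout_pi; congr (pushout_pi f g (_, _)).
by rewrite /= pact0.
Qed.

(** The images of the two injections generate the quotient, so a morphism out of it is determined by
    its composites with them. *)
Lemma pushout_pi_inlr p :
  pushout_pi f g p = pushout_inl f g p.1 + pushout_inr f g p.2.
Proof.
rewrite /pushout_inl /pushout_inr -pushout_piD; congr (pushout_pi f g _).
by case: p => a b; congr (_, _); rewrite /= ?addr0 ?add0r.
Qed.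

Lemma pushout_inlr_comm : pushout_inl f g \o f =1 pushout_inr f g \o g.
Proof.
(* The representatives [(f x, 0)] and [(0, g x)] differ by the antidiagonal element of [x]
   itself. *)
move=> x; apply/pushout_pi_eq/asboolP; exists x.
by congr (_, _); rewrite /= ?subr0 ?sub0r.
Qed.

Section Mediating.
Variables (X : pmodType T) (u : A -> X) (v : B -> X).
Hypotheses (u_pmod : pmod_morphism u) (v_pmod : pmod_morphism v).
Hypothesis uf_vg : u \o f =1 v \o g.

Definition pushout_mediating (x : pushout f g) : X :=
  u (generic_quotient.repr x).1 + v (generic_quotient.repr x).2.

(** Independence of the chosen representative: two representatives differ by some [(f x, - g x)],
    and this contributes [u (f x) - v (g x)], which is zero by the cocone identity. *)
Lemma pushout_mediating_pi p :
  pushout_mediating (pushout_pi f g p) = u p.1 + v p.2.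
Proof.
(* The chosen representative becomes an arbitrary [q], of which only its class is remembered. *)
have [q /esym qp ->] : exists2 q, pushout_pi f g p = pushout_pi f g q &
    pushout_mediating (pushout_pi f g p) = u q.1 + v q.2.
  exists (generic_quotient.repr (pushout_pi f g p)) => //.
  by rewrite {2}/pushout_pi generic_quotient.reprK.
have /pushout_pi_eq/asboolP[x] := qp.
case: q p {qp} => [a b] [a' b'] /= [/(canRL (subrK _)) -> /(canRL (subrK _)) ->].
rewrite (pmod_morphismD u_pmod) (pmod_morphismD v_pmod).
rewrite (pmod_morphismN v_pmod) -[u (f x)]/((u \o f) x) uf_vg /=.
by rewrite addrACA subrr add0r.
Qed.

Lemma pushout_mediating_morphism : pmod_morphism pushout_mediating.
Proof.
split=> [x y|t x].
  have [[p ->] [q ->]] := (pushout_piP x, pushout_piP y).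
  rewrite -pushout_piB !pushout_mediating_pi (pmod_morphismB u_pmod).
  by rewrite (pmod_morphismB v_pmod) opprD addrACA.
have [p ->] := pushout_piP x.
rewrite pact_pushout_pi !pushout_mediating_pi pactD.
by rewrite (pmod_morphismZ u_pmod) (pmod_morphismZ v_pmod).
Qed.

Lemma pushout_mediating_inl : pushout_mediating \o pushout_inl f g =1 u.
Proof.
by move=> a; rewrite /= pushout_mediating_pi (pmod_morphism0 v_pmod) addr0.
Qed.

Lemma pushout_mediating_inr : pushout_mediating \o pushout_inr f g =1 v.
Proof.
by move=> b; rewrite /= pushout_mediating_pi (pmod_morphism0 u_pmod) add0r.
Qed.

Lemma pushout_mediating_uniq (w : pushout f g -> X) : pmod_morphism w ->
  w \o pushout_inl f g =1 u -> w \o pushout_inr f g =1 v ->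
  w =1 pushout_mediating.
Proof.
move=> w_pmod wl wr x; have [p ->] := pushout_piP x.
by rewrite pushout_mediating_pi pushout_pi_inlr (pmod_morphismD w_pmod) -wl -wr.
Qed.

End Mediating.

Theorem pushout_pmod_pushout :
  pmod_pushout f g (pushout_inl f g) (pushout_inr f g).
Proof.
split; [exact: pushout_inl_morphism|exact: pushout_inr_morphism| |].
  exact: pushout_inlr_comm.
move=> X u v u_pmod v_pmod uf_vg; exists (pushout_mediating u v); split.
- exact: pushout_mediating_morphism.
- exact: pushout_mediating_inl.
- exact: pushout_mediating_inr.
- exact: pushout_mediating_uniq.
Qed.

End PointedModulePushout.

Section HeapPointedCorrespondence.
Variable T : trussType.

Lemma hmod_morphism_comp (L M N : hmodType T) (v : M -> N) (u : L -> M) :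
  hmod_morphism v -> hmod_morphism u -> hmod_morphism (v \o u).
Proof.
move=> [vB vact] [uB uact].
by split=> [a b c|t m n]; rewrite /= ?uB ?vB ?uact ?vact.
Qed.

Lemma heap_of_hbrE (A : pmodType T) (x y z : A) :
  [heap x : heap_of A, y, z] = x - y + z.
Proof. by []. Qed.

Lemma heap_of_hactE (A : pmodType T) t (x y : A) :
  hact t (x : heap_of A) y = pact t y - pact t x + x.
Proof. by []. Qed.

Lemma pmod_heap_of_morphism (A B : pmodType T) (w : A -> B) :
  pmod_morphism w -> @hmod_morphism T (heap_of A) (heap_of B) w.
Proof.
move=> wP; split=> [x y z|t x y]; rewrite ?heap_of_hbrE ?heap_of_hactE.
  by rewrite (pmod_morphismD wP) (pmod_morphismB wP).
by rewrite (pmod_morphismD wP) (pmod_morphismB wP) !(pmod_morphismZ wP).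
Qed.

(** The bracket with last entry [0] is subtraction, and the action based at [0] is the pointed
    action. *)
Lemma heap_of_pmod_morphism (A B : pmodType T) (w : A -> B) :
  @hmod_morphism T (heap_of A) (heap_of B) w -> w 0 = 0 -> pmod_morphism w.
Proof.
move=> [wB wact] w0; split=> [x y|t x].
  by have := wB x y 0; rewrite !heap_of_hbrE w0 !addr0.
by have := wact t 0 x; rewrite !heap_of_hactE w0 !pact0 !subr0 !addr0.
Qed.

(** Passing to the retract at [e] and back recovers the structure of [M]; for the action this is the
    base change axiom [hact_base] at [e]. *)
Lemma heap_of_retract_morphism (M : hmodType T) (e : M) :
  @hmod_morphism T (heap_of (retract e)) M id.
Proof.
split=> [x y z|t x y]; first exact: retract_brE.
by rewrite heap_of_hactE retract_brE [RHS](hact_base t _ _ e).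
Qed.

Lemma retract_heap_of_morphism (M : hmodType T) (e : M) :
  @hmod_morphism T M (heap_of (retract e)) id.
Proof.
have [idB idact] := heap_of_retract_morphism e.
by split=> [x y z|t x y]; [apply: esym; exact: idB | apply: esym; exact: idact].
Qed.

(** The equation [u e = x] says that zero is preserved. The base point [x] is kept separate from
    [u e] because [v (g e)] and [u (f e)] are equal only by the cocone identity, not by
    conversion. *)
Lemma hmod_retract_morphism (M N : hmodType T) (u : M -> N) (e : M) (x : N) :
  hmod_morphism u -> u e = x -> @pmod_morphism T (retract e) (retract x) u.
Proof.
move=> u_hmod uex; apply: heap_of_pmod_morphism => //.
apply: hmod_morphism_comp (retract_heap_of_morphism x) _.
exact: hmod_morphism_comp u_hmod (heap_of_retract_morphism e).
Qed.

(** Stated for an arbitrary pushout [P] of the retracts, since the universal property alone is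
    transferred. *)
Theorem retract_hmod_pushout (G K H : hmodType T)
    (f : G -> K) (g : G -> H) (e : G) (P : pmodType T)
    (iK : retract (f e) -> P) (iH : retract (g e) -> P) :
  pmod_pushout (retract_map f e) (retract_map g e) iK iH ->
  hmod_pushout (P := heap_of P) f g iK iH.
Proof.
move=> [iK_pmod iH_pmod iC univ]; split=> //.
- exact: (hmod_morphism_comp (pmod_heap_of_morphism iK_pmod)
    (retract_heap_of_morphism (f e))).
- exact: (hmod_morphism_comp (pmod_heap_of_morphism iH_pmod)
    (retract_heap_of_morphism (g e))).
move=> X u v u_hmod v_hmod uf_vg.
(* Both legs send their base points to [u (f e)]: for [v] this is the cocone identity at [e]. *)
have [||//|w [w_pmod wK wH w_uniq]] := univ (retract (u (f e))) u v.
- exact: hmod_retract_morphism.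
- by apply: hmod_retract_morphism => //; rewrite -[LHS]uf_vg.
exists w; split=> // [|w' w'_hmod w'K w'H].
  exact: (hmod_morphism_comp (heap_of_retract_morphism (u (f e)))
    (pmod_heap_of_morphism w_pmod)).
apply: w_uniq => //; apply: heap_of_pmod_morphism.
  exact: (hmod_morphism_comp (retract_heap_of_morphism (u (f e))) w'_hmod).
by rewrite -(pmod_morphism0 iK_pmod); exact: w'K.
Qed.

End HeapPointedCorrespondence.

Theorem mainTheorem7 (T : trussType) (G K H : hmodType T)
    (f : {hmod G -> K}) (g : {hmod G -> H}) (e : G) :
  pmod_pushout (retract_map f e) (retract_map g e) (eta_l f g e) (eta_r f g e)
  /\ hmod_pushout (P := heap_of (retract_pushout f g e)) f g
       (eta_l f g e) (eta_r f g e).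
Proof.
(* By conversion, [eta_l] and [eta_r] are the injections into the quotient. *)
have pP : pmod_pushout (retract_map f e) (retract_map g e)
    (eta_l f g e) (eta_r f g e) := pushout_pmod_pushout _ _.
by split; [exact: pP | exact: retract_hmod_pushout pP].
Qed.
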